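(* Let $(A_{\mathrm{AdS}}(\rho),\phi(\rho))$ be a proper domain wall solution of AdS$_3$-Einstein-dilaton gravity, with Virasoro central charges $c^{\mathrm{UV}}$ at $\rho\to\infty$ and $c^{\mathrm{IR}}$ at $\rho\to-\infty$. Let $(A(r),\phi(r))$ be a corresponding proper flat-space domain wall solution, with $\mathfrak{bms}_3$ central charges $c_{\mathrm M}^{\mathrm{UV}}$ at $r\to\infty$ and $c_{\mathrm M}^{\mathrm{IR}}$ at $r\to-\infty$. Then $$\frac{c^{\mathrm{UV}}}{c^{\mathrm{IR}}}=\frac{c_{\mathrm M}^{\mathrm{UV}}}{c_{\mathrm M}^{\mathrm{IR}}}.$$
   Context: **Equations of motion.** For a 3d Lorentzian metric $g$, a real scalar $\phi$ and a potential $V$ (action $\frac{1}{16\pi G_N}\int d^3x\sqrt{-g}\,(R-\frac12(\partial\phi)^2-V(\phi))$, Newton constant $G_N>0$): $$R_{\mu\nu}-\tfrac12 g_{\mu\nu}R=\tfrac12\partial_\mu\phi\,\partial_\nu\phi-\tfrac14(\partial\phi)^2g_{\mu\nu}-\tfrac12V(\phi)g_{\mu\nu},\qquad \nabla^2\phi=V'(\phi).$$ **Proper AdS$_3$ domain wall.** A proper domain wall solution of AdS$_3$-Einstein-dilaton gravity is an exact solution of these equations, with some potential of the form $V(\phi)=-2+\frac12m^2\phi^2+\dots$ (higher powers of $\phi$), with metric $ds^2=d\rho^2+e^{2A_{\mathrm{AdS}}(\rho)}(-dt^2+dx^2)$ and $\phi=\phi(\rho)$, $\rho\in\mathbb R$,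 such that: 1. for $\rho\to\infty$ the metric asymptotes to Poincaré patch AdS$_3$ with unit AdS radius, i.e. $A_{\mathrm{AdS}}(\rho)=\rho+\mathrm{const}+o(1)$, and $\phi\to0$; 2. for $\rho\to-\infty$ the metric asymptotes to Poincaré patch AdS$_3$ with AdS radius $\ell_{\mathrm{IR}}$ smaller than one, i.e. $A_{\mathrm{AdS}}(\rho)=\rho/\ell_{\mathrm{IR}}+\mathrm{const}+o(1)$, and $\phi$ approaches a constant (possibly zero); 3. for finite $\rho$ the functions $A_{\mathrm{AdS}}$ and $\phi$ are bounded and real; $A_{\mathrm{AdS}}$ is at least $C^2$ and $\phi$ at least $C^1$. **Proper flat-space domain wall.** A proper flat-space domain wall solution is an exact solution of the same equations with $V=0$, with metric $ds^2=-2e^{A(r)}\,du\,dr+e^{2A(r)}\,d\varphi^2$ and $\phi=\phi(r)$, $r\in\mathbb R$, such that: 1. for $r\to\infty$ the metric asymptotes to the null orbifold $-2\,du\,d\varrho+\varrho^2d\varphi^2$ (with $\varrho=e^{r-r_0}$), i.e. $A(r)=r-r_0+o(1)$ for some constant $r_0$, and $\phi\to0$; 2. for $r\to-\infty$ the metric asymptotes to the null orbifold with a possibly rescaled first term, $-2\lambda\,du\,d\varrho+\varrho^2d\varphi^2$ with some $\lambda>0$ (with $\varrho=e^{(r-r_1)/\lambda}$), i.e. $A(r)=\lambda^{-1}(r-r_1)+o(1)$ for some constant $r_1$, and $\phi$ approaches a constant (possibly zero); 3. for finite $r$ the functions $A$ and $\phi$ are bounded and real; $A$ is at least $C^2$ and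 $\phi$ at least $C^1$. **Correspondence.** The flat-space domain wall corresponding to a given AdS$_3$ domain wall is one whose scalar field $\phi(r)$ is the same function as the AdS$_3$ scalar field $\phi(\rho)$, with $\rho$ renamed $r$. **Central charges.** An asymptotically AdS$_3$ region with AdS radius $\ell$ has Brown–Henneaux Virasoro central charge $\frac{3\ell}{2G_N}$; thus $c^{\mathrm{UV}}=\frac{3}{2G_N}$ and $c^{\mathrm{IR}}=\frac{3\ell_{\mathrm{IR}}}{2G_N}$. An asymptotic region where the flat-space domain wall metric asymptotes to $-2\lambda\,du\,d\varrho+\varrho^2d\varphi^2$ has an asymptotic $\mathfrak{bms}_3$ symmetry algebra with mixed central charge $c_{\mathrm M}=\frac{3\lambda}{G_N}$ (the central term $\frac{c_{\mathrm M}}{12}n(n^2-1)\delta_{n+m,0}$ in $[L_n,M_m]$, with fixed normalization of generators); thus $c_{\mathrm M}^{\mathrm{UV}}=\frac{3}{G_N}$ and $c_{\mathrm M}^{\mathrm{IR}}=\frac{3\lambda}{G_N}$ with $\lambda$ the constant of the region $r\to-\infty$. *)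

(* Defs.v *)
From HB Require Import structures.
From mathcomp Require Import all_boot all_order all_algebra.
From mathcomp Require Import all_classical all_reals all_analysis.

Set Implicit Arguments.
Unset Strict Implicit.
Unset Printing Implicit Defensive.

Import Order.TTheory GRing.Theory Num.Theory.
Import numFieldNormedType.Exports.

Local Open Scope classical_set_scope.
Local Open Scope ring_scope.

Section Geometry.
Context {R : realType}.

Implicit Types (g : 'rV[R]_3 -> 'M[R]_3) (f Phi : 'rV[R]_3 -> R).

Definition partial (i : 'I_3) f (p : 'rV[R]_3) : R := 'D_(delta_mx 0 i) f p.

(* Gamma^k_{ij} of the Levi-Civita connection; invmx (g p) is g^{kl}. *)
Definition christoffel g (k i j : 'I_3) (p : 'rV[R]_3) : R :=
  2^-1 * \sum_(l < 3) invmx (g p) k l *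
    (partial i (fun q => g q l j) p + partial j (fun q => g q l i) p
     - partial l (fun q => g q i j) p).

(* Sign convention: R_{ij} = (n - 1) g_{ij} on the unit n-sphere. *)
Definition ricci g (i j : 'I_3) (p : 'rV[R]_3) : R :=
  \sum_(k < 3) (partial k (christoffel g k i j) p
                - partial j (christoffel g k i k) p)
  + \sum_(k < 3) \sum_(l < 3)
      (christoffel g k k l p * christoffel g l i j p
       - christoffel g k j l p * christoffel g l i k p).

Definition scalar_curvature g (p : 'rV[R]_3) : R :=
  \sum_(i < 3) \sum_(j < 3) invmx (g p) i j * ricci g i j p.

(* The components nabla^i Phi = g^{ij} d_j Phi. *)
Definition gradient g Phi (i : 'I_3) (p : 'rV[R]_3) : R :=
  \sum_(j < 3) invmx (g p) i j * partial j Phi p.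

Definition gradient_sq g Phi (p : 'rV[R]_3) : R :=
  \sum_(i < 3) gradient g Phi i p * partial i Phi p.

(* nabla_i nabla^i Phi, as the covariant divergence of the gradient. *)
Definition dalembertian g Phi (p : 'rV[R]_3) : R :=
  \sum_(i < 3) (partial i (gradient g Phi i) p
    + \sum_(j < 3) christoffel g i i j p * gradient g Phi j p).

Definition einstein_equation (V : R -> R) g Phi : Prop :=
  forall (p : 'rV[R]_3) (i j : 'I_3),
    ricci g i j p - 2^-1 * g p i j * scalar_curvature g p =
    2^-1 * partial i Phi p * partial j Phi p
    - 4^-1 * gradient_sq g Phi p * g p i j
    - 2^-1 * V (Phi p) * g p i j.

(* 'D and derive1 are total and take a junk value where the derivative does
   not exist, so existence of the derivatives involved is part of the equation
   (the metric derivatives in the curvature exist for the walls below, as A is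
   C^2 there). Only the diagonal derivatives d_i (nabla^i Phi) occur, which does
   not force Phi to be C^2 where its gradient is null. *)
Definition scalar_equation (V : R -> R) g Phi : Prop :=
  forall p : 'rV[R]_3,
    [/\ forall i : 'I_3, derivable (gradient g Phi i) p (delta_mx 0 i),
        derivable V (Phi p) 1
      & dalembertian g Phi p = derive1 V (Phi p)].

Definition einstein_dilaton_solution (V : R -> R) g Phi : Prop :=
  einstein_equation V g Phi /\ scalar_equation V g Phi.

End Geometry.

Section DomainWalls.
Context {R : realType}.
Implicit Types (A phi : R -> R) (l lam G c : R).

Definition class_C1 (f : R -> R) : Prop :=
  (forall x, derivable f x 1) /\ continuous (derive1 f).

Definition class_C2 (f : R -> R) : Prop :=
  (forall x, derivable f x 1) /\ class_C1 (derive1 f).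

Definition mx3 (rows : seq (seq R)) : 'M[R]_3 :=
  \matrix_(i < 3, j < 3) nth 0 (nth [::] rows i) j.

(* Coordinates (rho, t, x): d rho^2 + e^{2A} (- dt^2 + dx^2). *)
Definition ads_metric A (p : 'rV[R]_3) : 'M[R]_3 :=
  let rho := p 0 0 in
  mx3 [:: [:: 1; 0; 0];
          [:: 0; - expR (2 * A rho); 0];
          [:: 0; 0; expR (2 * A rho)]].

(* Coordinates (r, u, varphi): - 2 e^A du dr + e^{2A} dvarphi^2, so
   g_{ur} = g_{ru} = - e^A. *)
Definition flat_metric A (p : 'rV[R]_3) : 'M[R]_3 :=
  let r := p 0 0 in
  mx3 [:: [:: 0; - expR (A r); 0];
          [:: - expR (A r); 0; 0];
          [:: 0; 0; expR (2 * A r)]].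

(* In both charts the radial coordinate is the one with index 0. *)
Definition radial_field phi (p : 'rV[R]_3) : R := phi (p 0 0).

(* V(x) = - 2 + m^2 x^2 / 2 + higher powers; the mass squared may be
   negative. *)
Definition ads_potential (V : R -> R) : Prop :=
  exists msq : R,
    (fun x : R => V x - (- 2 + 2^-1 * msq * x ^+ 2))
      =o_ (0 : R) (fun x : R => x ^+ 2).

(* Along F (either +oo or -oo) the metric asymptotes to Poincare patch AdS_3
   of radius l:  A(rho) = rho / l + const + o(1). *)
Definition ads_region (F : set_system R) A l : Prop :=
  0 < l /\ exists a : R, (fun rho : R => A rho - rho / l) @ F --> a.

(* Along F the metric asymptotes to - 2 lam du dvarrho + varrho^2 dvarphi^2
   with varrho = e^{(r - r0) / lam}:  A(r) = (r - r0) / lam + o(1). *)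
Definition null_orbifold_region (F : set_system R) A lam : Prop :=
  0 < lam /\ exists r0 : R, (fun r : R => A r - (r - r0) / lam) @ F --> (0 : R).

(* Boundedness of A and phi at finite rho is implied by their being
   continuous functions R -> R. *)
Definition proper_ads_domain_wall A phi : Prop :=
  [/\ exists2 V : R -> R, ads_potential V
        & einstein_dilaton_solution V (ads_metric A) (radial_field phi),
      ads_region (pinfty_nbhs R) A 1 /\ phi @ +oo --> (0 : R),
      (exists2 l_IR : R, l_IR < 1 & ads_region (ninfty_nbhs R) A l_IR)
        /\ (exists phi_IR : R, phi @ -oo --> phi_IR)
    & class_C2 A /\ class_C1 phi].

Definition proper_flat_domain_wall A phi : Prop :=
  [/\ einstein_dilaton_solution (fun=> 0) (flat_metric A) (radial_field phi),
      null_orbifold_region (pinfty_nbhs R) A 1 /\ phi @ +oo --> (0 : R),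
      (exists lam : R, null_orbifold_region (ninfty_nbhs R) A lam)
        /\ (exists phi_IR : R, phi @ -oo --> phi_IR)
    & class_C2 A /\ class_C1 phi].

(* c is the Brown-Henneaux central charge of the asymptotic region F. *)
Definition virasoro_central_charge G (F : set_system R) A c : Prop :=
  exists2 l : R, ads_region F A l & c = 3 * l / (2 * G).

(* cM is the mixed central charge of the bms_3 algebra of the asymptotic
   region F: the central term of [L_n, M_m] is
   (cM / 12) n (n^2 - 1) delta_{n + m, 0}. *)
Definition bms_central_charge G (F : set_system R) A cM : Prop :=
  exists2 lam : R, null_orbifold_region F A lam & cM = 3 * lam / G.

End DomainWalls.

(* Main.v *)
(* For both walls the Einstein equations imply A'' = - phi'^2 / 2: for AdS_3 this
   is the rhorho equation plus e^{-2A} times the tt equation, in which V, the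
   scalar curvature and the gradient-squared term cancel; for
   the flat wall it is the rr equation alone, since g_rr = 0. Corresponding
   walls share phi, so A_AdS - A is affine. Its slope is 1/l - 1/lambda at
   either end, and it vanishes at the UV end; hence l = lambda at both ends. *)
Require Import Defs.
From HB Require Import structures.
From mathcomp Require Import all_boot all_order all_algebra.
From mathcomp Require Import all_classical all_reals all_analysis.
From mathcomp Require Import ring lra.
Import Order.TTheory GRing.Theory Num.Theory.
Import numFieldNormedType.Exports.
Local Open Scope classical_set_scope.
Local Open Scope ring_scope.

(** * Radial derivatives and inverse metrics *)

(** Along index [0] the two difference quotients are the same function, and along any other index
    the quotient is constantly [0]. Since limits of equal functions are compared, no
    differentiability of [f] is assumed. *)
Lemma partial_radial (R : realType) (f : R -> R) (i : 'I_3) (p : 'rV[R]_3) :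
  partial i (fun q => f (q 0 0)) p = derive1 f (p 0 0) *+ (i == 0).
Proof.
rewrite /partial derive1E /derive.
have -> : (fun h : R => h^-1 *: (f ((h *: delta_mx 0 i + p : 'rV[R]_3) 0 0) - f (p 0 0)))
   = (fun h : R => h^-1 *: (f (h *+ (i == 0) + p 0 0) - f (p 0 0))).
  by apply/funext => h; rewrite !mxE /= mulr_natr eq_sym.
case: (i == 0).
  under [in RHS]eq_fun do rewrite [_ *: 1]mulr1.
  by [].
under eq_fun do rewrite mulr0n add0r subrr scaler0.
by rewrite lim_cst.
Qed.

Lemma invmx_eq (R : comUnitRingType) (n : nat) (B C : 'M[R]_n) :
  B *m C = 1%:M -> invmx B = C.
Proof.
move=> BC; have [Bu _] := mulmx1_unit BC.
by rewrite -[LHS]mulmx1 -BC mulKmx.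
Qed.

Lemma invmx_ads (R : realType) (A : R -> R) (p : 'rV[R]_3) :
  invmx (ads_metric A p) =
  mx3 [:: [:: 1; 0; 0];
          [:: 0; - expR (- (2 * A (p 0 0))); 0];
          [:: 0; 0; expR (- (2 * A (p 0 0)))]].
Proof.
apply: invmx_eq; apply/matrixP => i j.
rewrite !mxE !big_ord_recl big_ord0 !mxE.
case: i => -[|[|[|//]]] ?; case: j => -[|[|[|//]]] ? //=;
rewrite !(mulr0,mul0r,mulr1,addr0,add0r) ?mulrNN -?expRD ?subrr ?expR0 //.
Qed.

Lemma invmx_flat (R : realType) (A : R -> R) (p : 'rV[R]_3) :
  invmx (flat_metric A p) =
  mx3 [:: [:: 0; - expR (- A (p 0 0)); 0];
          [:: - expR (- A (p 0 0)); 0; 0];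
          [:: 0; 0; expR (- (2 * A (p 0 0)))]].
Proof.
apply: invmx_eq; apply/matrixP => i j.
rewrite !mxE !big_ord_recl big_ord0 !mxE.
case: i => -[|[|[|//]]] ?; case: j => -[|[|[|//]]] ? //=;
rewrite !(mulr0,mul0r,mulr1,addr0,add0r) ?mulrNN -?expRD ?subrr ?expR0 //.
Qed.

(** * Christoffel symbols of the two walls *)

Lemma derivable_expR_comp (R : realType) (f : R -> R) (x : R) :
  derivable f x 1 -> derivable (fun y => expR (f y)) x 1.
Proof.
by move=> df; case: (is_derive1_comp (is_derive_expR (f x)) (derivableP df)).
Qed.

Lemma derive1_expR (R : realType) (f : R -> R) (x : R) :
  derivable f x 1 -> derive1 (fun y => expR (f y)) x = derive1 f x * expR (f x).
Proof.
move=> df.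
rewrite derive1E (@derive_val _ _ _ _ _ _ _
  (is_derive1_comp (is_derive_expR (f x)) (derivableP df))).
by rewrite -derive1E mulrC.
Qed.

(* ads_connection A k i j is Gamma^k_{ij}; k, i, j are nat so that the tables
   reduce once the ordinals are explicit. *)
Definition ads_connection {R : realType} (A : R -> R) (k i j : nat) (r : R) : R :=
  match k, i, j with
  | 0, 1, 1 => derive1 A r * expR (2 * A r)
  | 0, 2, 2 => - (derive1 A r * expR (2 * A r))
  | 1, 0, 1 | 1, 1, 0 | 2, 0, 2 | 2, 2, 0 => derive1 A r
  | _, _, _ => 0
  end.

Definition flat_connection {R : realType} (A : R -> R) (k i j : nat) (r : R) : R :=
  match k, i, j with
  | 1, 2, 2 => derive1 A r * expR (A r)
  | 0, 0, 0 | 2, 0, 2 | 2, 2, 0 => derive1 A r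
  | _, _, _ => 0
  end.

Lemma derive1_expR2 (R : realType) (A : R -> R) (x : R) :
  derivable A x 1 ->
  derive1 (fun y => expR (2 * A y)) x = 2 * derive1 A x * expR (2 * A x).
Proof.
move=> dA; rewrite derive1_expR; last exact: derivableZ.
by rewrite derive1Ml.
Qed.

Lemma partial_ads (R : realType) (A : R -> R) (i l j : 'I_3) (p : 'rV[R]_3) :
  derivable A (p 0 0) 1 ->
  partial i (fun q => ads_metric A q l j) p =
  mx3 [:: [:: 0; 0; 0];
          [:: 0; - (2 * derive1 A (p 0 0) * expR (2 * A (p 0 0))); 0];
          [:: 0; 0; 2 * derive1 A (p 0 0) * expR (2 * A (p 0 0))]] l j *+ (i == 0).
Proof.
move=> dA.
rewrite (partial_radial _ (fun r => mx3 [:: [:: 1; 0; 0];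
          [:: 0; - expR (2 * A r); 0];
          [:: 0; 0; expR (2 * A r)]] l j)).
congr (_ *+ _); rewrite mxE; under eq_fun do rewrite mxE.
have d2 : derivable (fun y => expR (2 * A y)) (p 0 0) 1.
  exact/derivable_expR_comp/derivableZ.
case: l => -[|[|[|//]]] ?; case: j => -[|[|[|//]]] ? /=;
  by [rewrite derive1_cst|rewrite derive1_expR2|rewrite derive1N ?derive1_expR2].
Qed.

Lemma partial_flat (R : realType) (A : R -> R) (i l j : 'I_3) (p : 'rV[R]_3) :
  derivable A (p 0 0) 1 ->
  partial i (fun q => flat_metric A q l j) p =
  mx3 [:: [:: 0; - (derive1 A (p 0 0) * expR (A (p 0 0))); 0];
          [:: - (derive1 A (p 0 0) * expR (A (p 0 0))); 0; 0];
          [:: 0; 0; 2 * derive1 A (p 0 0) * expR (2 * A (p 0 0))]] l j *+ (i == 0).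
Proof.
move=> dA.
rewrite (partial_radial _ (fun r => mx3 [:: [:: 0; - expR (A r); 0];
          [:: - expR (A r); 0; 0];
          [:: 0; 0; expR (2 * A r)]] l j)).
congr (_ *+ _); rewrite mxE; under eq_fun do rewrite mxE.
have d1 : derivable (fun y => expR (A y)) (p 0 0) 1.
  exact: derivable_expR_comp.
case: l => -[|[|[|//]]] ?; case: j => -[|[|[|//]]] ? /=;
  by [rewrite derive1_cst|rewrite derive1_expR2|rewrite derive1N ?derive1_expR].
Qed.

Lemma christoffel_ads (R : realType) (A : R -> R) (k i j : 'I_3) :
  (forall x, derivable A x 1) ->
  christoffel (ads_metric A) k i j = fun p => ads_connection A k i j (p 0 0).
Proof.
move=> dA; apply/funext => p.
rewrite /christoffel invmx_ads.
under eq_bigr do rewrite !partial_ads //.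
rewrite !big_ord_recl big_ord0 !mxE.
have := expRxMexpNx_1 (2 * A (p 0 0)).
set e := expR _; set e' := expR _ => ee'.
case: k => -[|[|[|//]]] ?; case: i => -[|[|[|//]]] ?;
case: j => -[|[|[|//]]] ? //=;
rewrite ?(mulr0n,mulr1n,mulr0,mul0r,mul1r,subr0,addr0,add0r) //.
all: rewrite -/e; set a : R := derive1 A _.
(* These are the symbols with upper index [0], where [g^{rho rho} = 1]; all the others pair an
   exponential with its inverse and need [e * e' = 1]. *)
1-2: by field.
all: transitivity (a * (e * e')); [by field|by rewrite ee' mulr1].
Qed.

Lemma christoffel_flat (R : realType) (A : R -> R) (k i j : 'I_3) :
  (forall x, derivable A x 1) ->
  christoffel (flat_metric A) k i j = fun p => flat_connection A k i j (p 0 0).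
Proof.
move=> dA; apply/funext => p.
rewrite /christoffel invmx_flat.
under eq_bigr do rewrite !partial_flat //.
rewrite !big_ord_recl big_ord0 !mxE.
have := expRxMexpNx_1 (A (p 0 0)).
have := expRxMexpNx_1 (2 * A (p 0 0)).
(* [Gamma^1_{22}] multiplies [e^{2A}], from [g_{22}], by [e^{-A}], from the inverse metric, so the
   two exponentials must be related. *)
have : expR (2 * A (p 0 0)) = expR (A (p 0 0)) ^+ 2 by rewrite expRM_natl.
case: k => -[|[|[|//]]] ?; case: i => -[|[|[|//]]] ?;
case: j => -[|[|[|//]]] ? //=;
rewrite ?(mulr0n,mulr1n,mulr0,mul0r,mul1r,subr0,addr0,add0r,addrN,subrr) //.
all: move: (expR (2 * _)) (expR (- (2 * _))) (expR (A _)) (expR (- A _)).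
all: move=> d d' e e' de dd' ee'; set a : R := derive1 A _.
- by transitivity (a * (e * e')); [field|rewrite ee' mulr1].
- by transitivity (a * e * (e * e')); [rewrite de; field|rewrite ee' mulr1].
- by transitivity (a * (d * d')); [field|rewrite dd' mulr1].
- by transitivity (a * (d * d')); [field|rewrite dd' mulr1].
Qed.

(** * Ricci components *)

(** Only radial derivatives survive: [d_k Gamma^k_{ij}] keeps its [k = 0] term, and
    [d_j Gamma^k_{ik}] vanishes unless [j = 0]. *)
Lemma ricci_radial (R : realType) (g : 'rV[R]_3 -> 'M[R]_3)
    (Gam : nat -> nat -> nat -> R -> R) (i j : 'I_3) (p : 'rV[R]_3) :
  (forall k i j : 'I_3, christoffel g k i j = fun q => Gam k i j (q 0 0)) ->
  ricci g i j p =
  derive1 (Gam 0 i j) (p 0 0)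
  - (\sum_(k < 3) derive1 (Gam k i k) (p 0 0)) *+ (j == 0)
  + \sum_(k < 3) \sum_(l < 3)
      (Gam k k l (p 0 0) * Gam l i j (p 0 0)
       - Gam k j l (p 0 0) * Gam l i k (p 0 0)).
Proof.
move=> gE; rewrite /ricci; congr (_ + _); last first.
  by apply: eq_bigr => k _; apply: eq_bigr => l _; rewrite !gE.
rewrite sumrB; congr (_ - _).
  rewrite (bigD1 ord0) //= big1 => [|k /negPf k0]; rewrite gE partial_radial.
    by rewrite addr0.
  by rewrite k0.
by rewrite -sumrMnl; apply: eq_bigr => k _; rewrite gE partial_radial.
Qed.

Lemma ricci_ads_rr (R : realType) (A : R -> R) (p : 'rV[R]_3) :
  class_C2 A ->
  ricci (ads_metric A) 0 0 p =
  - 2 * (derive1 (derive1 A) (p 0 0) + derive1 A (p 0 0) ^+ 2).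
Proof.
move=> [dA [ddA _]].
rewrite (@ricci_radial _ _ (ads_connection A)); last first.
  by move=> k i j; exact: christoffel_ads.
rewrite !big_ord_recl !big_ord0 /= !derive1_cst -/(derive1 A).
set a : R := derive1 A _; set b : R := derive1 _ _.
ring.
Qed.

Lemma ricci_ads_tt (R : realType) (A : R -> R) (p : 'rV[R]_3) :
  class_C2 A ->
  ricci (ads_metric A) 1 1 p =
  (derive1 (derive1 A) (p 0 0) + 2 * derive1 A (p 0 0) ^+ 2) *
  expR (2 * A (p 0 0)).
Proof.
move=> [dA [ddA _]].
rewrite (@ricci_radial _ _ (ads_connection A)); last first.
  by move=> k i j; exact: christoffel_ads.
rewrite !big_ord_recl !big_ord0 /=.
have -> : derive1 (fun r => derive1 A r * expR (2 * A r)) (p 0 0) =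
   derive1 (derive1 A) (p 0 0) * expR (2 * A (p 0 0)) +
   2 * derive1 A (p 0 0) ^+ 2 * expR (2 * A (p 0 0)).
  rewrite derive1E deriveM //; last exact/derivable_expR_comp/derivableZ.
  rewrite -!derive1E derive1_expR2 //.
  set a : R := derive1 A _; set b : R := derive1 _ _; set e := expR _.
  by transitivity (a * (2 * a * e) + e * b); last ring.
set a : R := derive1 A _; set b : R := derive1 _ _.
ring.
Qed.

(** Here [Gamma^0_{00} = Gamma^2_{20} = A'], so both quadratic contractions equal [2 A'^2] and
    cancel, while the derivative terms give [A'' - 2 A'']. *)
Lemma ricci_flat_rr (R : realType) (A : R -> R) (p : 'rV[R]_3) :
  class_C2 A ->
  ricci (flat_metric A) 0 0 p = - derive1 (derive1 A) (p 0 0).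
Proof.
move=> [dA [ddA _]].
rewrite (@ricci_radial _ _ (flat_connection A)); last first.
  by move=> k i j; exact: christoffel_flat.
rewrite !big_ord_recl !big_ord0 /= !derive1_cst -/(derive1 A).
set a : R := derive1 A _; set b : R := derive1 _ _.
ring.
Qed.

(** * The common second-order equation for the warp factors *)

Lemma ads_wall_equation (R : realType) (V A phi : R -> R) (x : R) :
  class_C2 A -> einstein_equation V (ads_metric A) (radial_field phi) ->
  derive1 (derive1 A) x = - 2^-1 * derive1 phi x ^+ 2.
Proof.
move=> cA E; pose p : 'rV[R]_3 := const_mx x.
have := E p 0 0; have := E p 1 1.
rewrite ricci_ads_rr // ricci_ads_tt // !(partial_radial _ phi).
rewrite !mxE /= mulr0n mulr1n.
have := expR_gt0 (2 * A x).
(* Scalar curvature, squared gradient and potential stay uncomputed: they enter both equations in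
   the same combination, multiplied by the metric component. *)
move: (expR _) (scalar_curvature _ _) (gradient_sq _ _ _) (V _) => e S N v.
set a : R := derive1 A _; set b : R := derive1 _ _; set f : R := derive1 phi _.
move=> e0 E1 E0.
have : (b + 2 * a ^+ 2 + 2^-1 * S - 4^-1 * N - 2^-1 * v) * e = 0 by lra.
by move=> /eqP; rewrite mulf_eq0 (gt_eqF e0) orbF => /eqP; lra.
Qed.

Lemma flat_wall_equation (R : realType) (A phi : R -> R) (x : R) :
  class_C2 A ->
  einstein_equation (fun=> 0) (flat_metric A) (radial_field phi) ->
  derive1 (derive1 A) x = - 2^-1 * derive1 phi x ^+ 2.
Proof.
move=> cA E; pose p : 'rV[R]_3 := const_mx x.
have := E p 0 0.
rewrite ricci_flat_rr // !(partial_radial _ phi).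
rewrite !mxE /= mulr1n.
rewrite !(mulr0,mul0r,subr0).
set b : R := derive1 _ _; set f : R := derive1 phi _.
by lra.
Qed.

(** * Affine functions and asymptotic slopes *)

Lemma affine_of_derive2_eq0 (R : realType) (f : R -> R) :
  (forall x, derivable f x 1) -> (forall x, derivable (derive1 f) x 1) ->
  (forall x, derive1 (derive1 f) x = 0) ->
  exists a b : R, forall x, f x = a + b * x.
Proof.
move=> df ddf f2.
have cst_of (h : R -> R) : (forall x, derivable h x 1) ->
    (forall x, derive1 h x = 0) -> forall x, h x = h 0.
  move=> dh h0 x; apply: is_derive_0_is_cst => y.
  by rewrite -(h0 y) derive1E; exact/derivableP.
exists (f 0), (derive1 f 0) => x.
have dl y : derivable (fun y : R => derive1 f 0 * y) y 1.
  by apply: derivableZ; exact: derivable_id.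
(* Subtracting the linear part leaves the derivative [f' - f'(0)], which is [0] because [f'] is
   itself constant. *)
have := cst_of (fun y => f y - derive1 f 0 * y) _ _ x.
rewrite mulr0 subr0 => <-; first by rewrite subrK.
- by move=> y; apply: derivableB.
- move=> y; rewrite derive1E deriveB // -!derive1E derive1Ml //.
  by rewrite derive1_id mulr1 (cst_of _ ddf f2) subrr.
Qed.

(** The values at [x] and [x + 1] differ by [k], yet for [k] nonzero both would lie within [|k| / 2]
    of the limit. The condition on [F] supplies such pairs arbitrarily far along the filter. *)
Lemma linear_cvg_eq0 (R : realType) (F : set_system R) (FF : Filter F)
    (k c : R) :
  (forall P : set R, F P -> exists x, P x /\ P (x + 1)) ->
  (fun x : R => k * x) @ F --> c -> k = 0.
Proof.
move=> F1 /cvgrPdist_lt kc; apply/eqP; apply: contraT => k0.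
have /kc/F1[x /= [x1 x2]] : 0 < `|k| / 2 by rewrite divr_gt0 ?normr_gt0.
have : `|k| < `|k|.
  rewrite {2}(splitr `|k|).
  apply: le_lt_trans (ltrD x1 x2).
  rewrite -[X in `|X| <= _](_ : (c - k * x) - (c - k * (x + 1)) = k).
    exact: ler_normB.
  ring.
by rewrite ltxx.
Qed.

Lemma pinfty_nbhs_shift (R : realType) (P : set R) :
  (pinfty_nbhs R) P -> exists x, P x /\ P (x + 1).
Proof.
by move=> [M [_ MP]]; exists (M + 1); split; apply: MP; lra.
Qed.

Lemma ninfty_nbhs_shift (R : realType) (P : set R) :
  (ninfty_nbhs R) P -> exists x, P x /\ P (x + 1).
Proof.
(* The bound is strict, so [x + 1] must also lie strictly below [M]; [M - 1] would fail. *)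
by move=> [M [_ MP]]; exists (M - 2); split; apply: MP; lra.
Qed.

(** Subtracting both asymptotic lines from [A - B] leaves a linear function plus a constant. It
    converges along [F], so its slope vanishes. *)
Lemma region_slope (R : realType) (F : set_system R) (FF : Filter F)
    (A B : R -> R) (a b l lam : R) :
  (forall P : set R, F P -> exists x, P x /\ P (x + 1)) ->
  (forall x, A x - B x = a + b * x) ->
  ads_region F A l -> null_orbifold_region F B lam -> b = l^-1 - lam^-1.
Proof.
move=> F1 AB [_ [u Au]] [_ [r Br]]; apply/eqP; rewrite -subr_eq0; apply/eqP.
have lin : (fun x => (b - (l^-1 - lam^-1)) * x) =
    (fun x => (A x - x / l) - (B x - (x - r) / lam) - (a - r / lam)).
  by apply/funext => x; have := AB x; lra.
apply: (linear_cvg_eq0 _ _ _ _ (u - 0 - (a - r / lam)) F1).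
by rewrite lin; apply: cvgB; [exact: cvgB|exact: cvg_cst].
Qed.

(** * Comparison of the central charges *)

Theorem theorem3 (R : realType) (G : R) (G_gt0 : 0 < G)
    (A_AdS A phi : R -> R)
    (ads_wall : proper_ads_domain_wall A_AdS phi)
    (flat_wall : proper_flat_domain_wall A phi)
    (c_UV c_IR cM_UV cM_IR : R)
    (hc_UV : virasoro_central_charge G (pinfty_nbhs R) A_AdS c_UV)
    (hc_IR : virasoro_central_charge G (ninfty_nbhs R) A_AdS c_IR)
    (hcM_UV : bms_central_charge G (pinfty_nbhs R) A cM_UV)
    (hcM_IR : bms_central_charge G (ninfty_nbhs R) A cM_IR) :
  c_UV / c_IR = cM_UV / cM_IR.
Proof.
case: ads_wall => [[V _ [EAdS _]] [AdS1 _] _ [C2AdS _]].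
case: flat_wall => [[Eflat _] [flat1 _] _ [C2flat _]].
have [[dA [ddA _]] [dB [ddB _]]] := (C2AdS, C2flat).
have dAB : derive1 (A_AdS - A) = derive1 A_AdS - derive1 A.
  by apply/funext => x; rewrite derive1E deriveB // -!derive1E.
have [||x|a [b AB]] := @affine_of_derive2_eq0 R (A_AdS - A).
- by move=> x; exact: derivableB.
- by move=> x; rewrite dAB; exact: derivableB.
- rewrite dAB derive1E deriveB // -!derive1E.
  rewrite (ads_wall_equation _ _ _ _ _ C2AdS EAdS).
  by rewrite (flat_wall_equation _ _ _ _ C2flat Eflat) subrr.
(* Stated for all [l] and [lam], since each central charge comes with its own region constant. *)
have slopeUV l lam : ads_region (pinfty_nbhs R) A_AdS l ->
    null_orbifold_region (pinfty_nbhs R) A lam -> b = l^-1 - lam^-1.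
  exact: region_slope (@pinfty_nbhs_shift R) AB.
have slopeIR l lam : ads_region (ninfty_nbhs R) A_AdS l ->
    null_orbifold_region (ninfty_nbhs R) A lam -> b = l^-1 - lam^-1.
  exact: region_slope (@ninfty_nbhs_shift R) AB.
(* At the UV end both walls have constant [1], so the slope is [1 - 1]. *)
have b0 : b = 0 by rewrite (slopeUV _ _ AdS1 flat1) subrr.
case: hc_UV => l lA ->; case: hc_IR => l' lA' ->.
case: hcM_UV => lam lB ->; case: hcM_IR => lam' lB' ->.
have := slopeUV _ _ lA lB; have := slopeIR _ _ lA' lB'.
rewrite b0 => /esym/eqP; rewrite subr_eq0 => /eqP/invr_inj <-.
move=> /esym/eqP; rewrite subr_eq0 => /eqP/invr_inj <-.
(* Both ratios are now [l / l']; positivity of [l'] and [G] makes the denominators nonzero. *)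
case: lA' => l'0 _; field.
by rewrite !gt_eqF.
Qed.
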